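(* Consider an ergodic Jackson network process $\mathbf{X}$ (setting in the context) with stationary distribution $\xi(\mathbf{n})=\prod_{j=1}^{J}\prod_{k=1}^{n_j}\frac{\eta_j}{\mu_j(k)}C(j)^{-1}$. Let $\boldsymbol{\gamma}=(\gamma_j:j\in\overline{J})\in[0,\infty)^{\overline{J}}$, $\|\boldsymbol{\gamma}\|_\infty=\max_j\gamma_j$, and define $\alpha_0=1$, $\alpha_j=\gamma_j$ for $j\in\overline{J}$ if $\|\boldsymbol{\gamma}\|_\infty\le1$ and $\alpha_j=\gamma_j/\|\boldsymbol{\gamma}\|_\infty$ if $\|\boldsymbol{\gamma}\|_\infty>1$; define $\beta=1$ if $\|\boldsymbol{\gamma}\|_\infty\le1$ and $\beta=\|\boldsymbol{\gamma}\|_\infty$ otherwise. Let $r^{(\boldsymbol{\alpha})}=(I-rI_{(1-\boldsymbol{\alpha})})^{-1}rI_{\boldsymbol{\alpha}}$ be the randomized-skipping modification of the extended routing matrix $r$ with $\boldsymbol{\alpha}=(\alpha_j:j\in\overline{J}_0)$. Let $\mathbf{X}^{(\boldsymbol{\gamma})}$ be the continuous-time Markov chain on $\mathbb{N}_0^{\overline{J}}$ whose positive transition rates are $q(\mathbf{n},\mathbf{n}+\mathbf{e}_i)=\beta\lambda r^{(\boldsymbol{\alpha})}(0,i)$ for $i\in\overline{J}$, $q(\mathbf{n},\mathbf{n}-\mathbf{e}_j+\mathbf{e}_i)=1_{[n_j>0]}\gamma_j\mu_j(n_j)r^{(\boldsymbol{\alpha})}(j,i)$ for $i,j\in\overline{J}$,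 $i\ne j$, and $q(\mathbf{n},\mathbf{n}-\mathbf{e}_j)=1_{[n_j>0]}\gamma_j\mu_j(n_j)r^{(\boldsymbol{\alpha})}(j,0)$ for $j\in\overline{J}$. Let $B(\boldsymbol{\gamma})=\{j\in\overline{J}:\gamma_j=0\}$ and $W(\boldsymbol{\gamma})=\overline{J}\setminus B(\boldsymbol{\gamma})$. Then $\xi$ is a stationary distribution of $\mathbf{X}^{(\boldsymbol{\gamma})}$. If $B(\boldsymbol{\gamma})=\emptyset$, then $\mathbf{X}^{(\boldsymbol{\gamma})}$ is ergodic. If $B(\boldsymbol{\gamma})\neq\emptyset$, then $\mathbf{X}^{(\boldsymbol{\gamma})}$ is not irreducible on $\mathbb{N}_0^{\overline{J}}$, its state space splits into the infinitely many closed subspaces $\mathbb{N}_0^{W(\boldsymbol{\gamma})}\times\{(n_j:j\in B(\boldsymbol{\gamma}))\}$, and for every probability distribution $\varphi$ on $\mathbb{N}_0^{B(\boldsymbol{\gamma})}$ the distribution \[ \xi^{(\boldsymbol{\gamma})}_\varphi(\mathbf{n})=\prod_{j\in W(\boldsymbol{\gamma})}\prod_{k=1}^{n_j}\frac{\eta_j}{\mu_j(k)}C(j)^{-1}\cdot\varphi(n_j:j\in B(\boldsymbol{\gamma})),\qquad \mathbf{n}\in\mathbb{N}_0^{\overline{J}}, \] is a stationary distribution of $\mathbf{X}^{(\boldsymbol{\gamma})}$.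
   Context: Jackson network setting: node set $\overline{J}=\{1,\dots,J\}$, extended node set $\overline{J}_0=\{0,1,\dots,J\}$ (0 = external source/sink). External Poisson arrivals at node $j$ with rates $\lambda_j\ge0$, $\lambda=\sum_j\lambda_j>0$; single servers with infinite waiting room, FCFS, service intensity $\mu_j(n_j)>0$ when $n_j>0$ customers are at node $j$. Extended routing matrix $r=(r(i,j):i,j\in\overline{J}_0)$ is stochastic and irreducible with $r(0,j)=\lambda_j/\lambda$, $r(0,0)=0$. $\eta=(\eta_j:j\in\overline{J}_0)$ is the extended traffic solution: $\eta_0=\lambda$ and $\eta_j=\sum_{i\in\overline{J}_0}\eta_i r(i,j)$ for all $j\in\overline{J}_0$. The Jackson network process $\mathbf{X}$ is the Markov chain on $\mathbb{N}_0^{\overline{J}}$ with rates $q(\mathbf{n},\mathbf{n}+\mathbf{e}_i)=\lambda r(0,i)$, $q(\mathbf{n},\mathbf{n}-\mathbf{e}_j+\mathbf{e}_i)=1_{[n_j>0]}\mu_j(n_j)r(j,i)$ ($i\neq j$), $q(\mathbf{n},\mathbf{n}-\mathbf{e}_j)=1_{[n_j>0]}\mu_j(n_j)r(j,0)$; it is assumed ergodic, and $C(j)=\sum_{n\ge0}\prod_{k=1}^n\eta_j/\mu_j(k)<\infty$. $\mathbf{e}_j$ is the $j$-th unit vector. $I_{\boldsymbol{\alpha}}$, $I_{(1-\boldsymbol{\alpha})}$ are diagonal matrices indexed by $\overline{J}_0$ with entries $\alpha_j$, resp. $1-\alpha_j$; $r^{(\boldsymbol{\alpha})}$ is the transition matrix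 of randomized skipping (a proposed next state $j$ drawn from the current row of $r$ is accepted with probability $\alpha_j$; if rejected, a new proposal is drawn from row $j$ of $r$ without time passing, until acceptance). *)

(* Defs.v *)
From HB Require Import structures.
From mathcomp Require Import all_boot all_order all_algebra.
From mathcomp Require Import all_classical all_reals all_analysis.
From Stdlib Require Import Relations.

Set Implicit Arguments.
Unset Strict Implicit.
Unset Printing Implicit Defensive.

Import Order.TTheory GRing.Theory Num.Theory.
Local Open Scope classical_set_scope.
Local Open Scope ring_scope.

(* General continuous-time Markov chains on a countable state space S,  *)
(* given by their transition rates q x y (only x <> y is relevant).     *)
Section CTMC.
Variables (R : realType) (S : choiceType).
Implicit Types (q : S -> S -> R) (pi : S -> R).

Definition qout q (x : S) : \bar R := \esum_(y in [set y | y != x]) (q x y)%:E.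

Definition stationary q pi : Prop :=
  [/\ (forall x, 0 <= pi x),
      \esum_(x in [set: S]) (pi x)%:E = 1%E &
      forall x, \esum_(y in [set y | y != x]) (pi y * q y x)%:E
              = \esum_(y in [set y | y != x]) (pi x * q x y)%:E].

Definition qstep q : relation S := fun x y => x <> y /\ 0 < q x y.

Definition ctmc_irreducible q : Prop :=
  forall x y, clos_refl_trans S (qstep q) x y.

Definition ctmc_closed q (A : set S) : Prop :=
  forall x y, A x -> qstep q x y -> A y.

Definition stable q : Prop := forall x, (qout q x < +oo)%E.

Definition jump q (x y : S) : R :=
  if y == x then (if fine (qout q x) == 0 then 1 else 0)
  else q x y / fine (qout q x).

(* first-passage probabilities of the jump chain into state i:          *)
(* fpass q i n x = P_x(first visit to i at step n), n >= 1.              *)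
Fixpoint fpass q (i : S) (n : nat) (x : S) : \bar R :=
  match n with
  | 0 => 0%E
  | m.+1 => ((if m is 0 then (jump q x i)%:E else 0%E) +
             \esum_(y in [set y | y != i]) ((jump q x y)%:E * fpass q i m y))%E
  end.

Definition jump_recurrent q : Prop :=
  forall i, \esum_(n in [set: nat]) fpass q i n i = 1%E.

(* ergodic = irreducible + positive recurrent (non-explosive).  For a    *)
(* stable irreducible chain this is: recurrent jump chain (which gives   *)
(* non-explosion and recurrence) + existence of a stationary distribution*)
(* (which then gives positive recurrence), cf. Norris Thm 3.4.1, 3.5.3. *)
Definition ergodic q : Prop :=
  [/\ stable q, ctmc_irreducible q, jump_recurrent q & exists pi, stationary q pi].

End CTMC.

(* Jackson networks.  Extended node set {0,...,J} = 'I_J.+1, with ord0  *)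
(* the external source/sink, and node j : 'I_J identified with          *)
(* ext j = lift ord0 j (i.e. the number j+1).                            *)
Definition ext (J : nat) (j : 'I_J) : 'I_J.+1 := lift ord0 j.

Notation state J := {ffun 'I_J -> nat}.

Definition plus_e J (n : state J) (i : 'I_J) : state J :=
  [ffun k => n k + (k == i)]%N.
Definition minus_e J (n : state J) (j : 'I_J) : state J :=
  [ffun k => n k - (k == j)]%N.

Section Jackson.
Variables (R : realType) (J : nat).

Definition stochastic (P : 'M[R]_J.+1) : Prop :=
  (forall i j, 0 <= P i j) /\ (forall i, \sum_j P i j = 1).

Definition mx_irreducible (P : 'M[R]_J.+1) : Prop :=
  forall i j, exists m : nat, 0 < (P ^+ m) i j.

(* Transition rates of a Jackson-type network with external arrival     *)
(* rates a i, service intensities s j k (k customers at j) and extended *)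
(* routing matrix P:                                                     *)
(*   n -> n + e_i           at rate a i                                  *)
(*   n -> n - e_j + e_i     at rate 1[n_j>0] s j n_j P(j,i), i <> j      *)
(*   n -> n - e_j           at rate 1[n_j>0] s j n_j P(j,0).             *)
(* (All these targets are pairwise distinct and distinct from n.)        *)
Definition jackson_rate (a : 'I_J -> R) (s : 'I_J -> nat -> R)
  (P : 'M[R]_J.+1) (n m : state J) : R :=
  \sum_(i < J) (m == plus_e n i)%:R * a i
  + \sum_(j < J) \sum_(i < J | i != j)
      ((0 < n j)%N && (m == plus_e (minus_e n j) i))%:R
        * s j (n j) * P (ext j) (ext i)
  + \sum_(j < J) ((0 < n j)%N && (m == minus_e n j))%:R
        * s j (n j) * P (ext j) ord0.

Definition cterm (eta : 'I_J.+1 -> R) (mu : 'I_J -> nat -> R) (j : 'I_J) (m : nat) : R :=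
  \prod_(1 <= k < m.+1) (eta (ext j) / mu j k).

Definition Cnorm eta mu (j : 'I_J) : \bar R :=
  \esum_(m in [set: nat]) (cterm eta mu j m)%:E.

Definition xi eta mu (n : state J) : R :=
  \prod_(j < J) (cterm eta mu j (n j) / fine (Cnorm eta mu j)).

Definition supnorm (gamma : 'I_J -> R) : R := \big[Num.max/0]_(j < J) gamma j.

Definition beta_of (gamma : 'I_J -> R) : R :=
  if supnorm gamma <= 1 then 1 else supnorm gamma.

Definition alpha_of (gamma : 'I_J -> R) (i : 'I_J.+1) : R :=
  match unlift ord0 i with
  | None => 1
  | Some j => if supnorm gamma <= 1 then gamma j else gamma j / supnorm gamma
  end.

Definition skip (P : 'M[R]_J.+1) (alpha : 'I_J.+1 -> R) : 'M[R]_J.+1 :=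
  invmx (1%:M - P *m diag_mx (\row_i (1 - alpha i)))
    *m P *m diag_mx (\row_i alpha i).

Definition restrictB (B : 'I_J -> bool) (n : state J) : state J :=
  [ffun j => if B j then n j else 0%N].

Definition xi_phi eta mu (B : 'I_J -> bool) (phi : state J -> R) (n : state J) : R :=
  (\prod_(j < J | ~~ B j) (cterm eta mu j (n j) / fine (Cnorm eta mu j)))
    * phi (restrictB B n).

End Jackson.

(* Main.v *)
Require Import Defs.
From HB Require Import structures.
From mathcomp Require Import all_boot all_order all_algebra.
From mathcomp Require Import all_classical all_reals all_analysis.
From mathcomp Require Import finmap ring zify.
From Stdlib Require Import Relations.
Import Order.TTheory GRing.Theory Num.Theory.
Local Open Scope classical_set_scope.
Local Open Scope ring_scope.

(** Write [n = n' + e_j] with [e_0 = 0].  The stationary flow of a Jackson-type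
    network along [n' + e_j -> n' + e_i] is [pi n' * theta_j * P j i], where
    [theta = theta P] is the throughput vector; hence the moves over each base
    state [n'] form a circulation and [pi] is stationary.  Randomized skipping
    with [theta_j = beta * alpha_j * eta_j] keeps [theta] invariant, because
    [eta (I - r I_(1-alpha)) = eta I_alpha], so the same [pi] works.

    Recurrence does not follow from the existence of [pi] alone, since service
    rates may be unbounded.  But testing global balance, on a finite set [A],
    against the probability of never returning to [o] shows that
    [pi o * q o * P_o(no return)] is at most the stationary flow out of [A].
    For [A = {n | |n| <= N}] this flow consists of external arrivals only, so
    it is at most [theta_0 * pi {n | |n| = N}], which is small for suitable
    [N] because [pi] is summable. *)

Set Implicit Arguments.
Unset Strict Implicit.
Unset Printing Implicit Defensive.

(** * Irreducible routing and randomized skipping *)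

Section IrreducibleMatrix.
Variables (R : realType) (J : nat) (P : 'M[R]_J.+1).
Hypotheses (P_st : stochastic P) (P_irr : mx_irreducible P).

Lemma stochastic_exp_ge0 m i j : 0 <= (P ^+ m) i j.
Proof.
elim: m i j => [|m IH] i j; first by rewrite expr0 mxE; case: eqP.
by rewrite exprS mxE sumr_ge0// => k _; rewrite mulr_ge0// P_st.1.
Qed.

(** A positive entry of [P ^+ m.+1] factors through some [k] with [P i k > 0], so paths can be
    followed entry by entry. This is the form in which irreducibility is used below. *)
Lemma irreducible_closed (S : 'I_J.+1 -> Prop) i : S i ->
  (forall k l, S k -> 0 < P k l -> S l) -> forall j, S j.
Proof.
move=> Si Sclosed j; have [m] := P_irr i j.
elim: m i Si => [|m IH] i Si.
  by rewrite expr0 mxE; case: eqP => [<-//|_]; rewrite ltxx.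
rewrite exprS mxE => /lt0r_neq0/eqP/psumr_neq0P[k _|k /andP[_ Pmk]].
  by rewrite mulr_ge0 ?P_st.1// stochastic_exp_ge0.
have [Pk0|Pk0] := eqVneq (P i k) 0; first by rewrite Pk0 mul0r ltxx in Pmk.
have Pk : 0 < P i k by rewrite lt_neqAle eq_sym Pk0 P_st.1.
by apply: (IH k); [apply: Sclosed Pk|rewrite -(pmulr_rgt0 _ Pk)].
Qed.

Lemma invariant_ge0_eq0 (v : 'I_J.+1 -> R) i0 :
  (forall i, 0 <= v i) -> (forall j, v j = \sum_i v i * P i j) ->
  v i0 = 0 -> forall i, v i = 0.
Proof.
move=> v0 vP vi0 i; apply/eqP; apply: contraT => vi.
suff : v i0 != 0 by rewrite vi0 eqxx.
apply: (irreducible_closed (S := fun k => v k != 0) vi) => k l vk Pkl.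
rewrite gt_eqF// vP (bigD1 k)//= ltr_pwDl ?sumr_ge0//; last first.
  by move=> ? _; rewrite mulr_ge0// P_st.1.
by rewrite mulr_gt0// lt_neqAle eq_sym vk v0.
Qed.

(** No sign is assumed on [v]. By the triangle inequality [|v|] is subinvariant, and row sums 1 turn
    this into equality. Then [|v| - v] is a nonnegative invariant vector vanishing at [i0], hence
    zero, and a zero of [|v|] would force [v i0 = 0]. *)
Lemma invariant_gt0 (v : 'I_J.+1 -> R) i0 :
  (forall j, v j = \sum_i v i * P i j) -> 0 < v i0 -> forall i, 0 < v i.
Proof.
move=> vP vi0.
have le_abs j : `|v j| <= \sum_i `|v i| * P i j.
  rewrite {1}vP; apply: le_trans (ler_norm_sum _ _ _) _.
  by apply: ler_sum => i _; rewrite normrM (ger0_norm (P_st.1 _ _)).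
have sum_eq : \sum_j (\sum_i `|v i| * P i j - `|v j|) = 0.
  rewrite sumrB exchange_big/= -sumrB big1// => i _.
  by rewrite -mulr_sumr P_st.2 mulr1 subrr.
have absP j : `|v j| = \sum_i `|v i| * P i j.
  apply/esym/eqP; rewrite -subr_eq0; apply/eqP.
  by apply: (psumr_eq0P _ sum_eq) => // i _; rewrite subr_ge0.
have := @invariant_ge0_eq0 (fun j => `|v j| - v j) i0 _ _ _ _ => /= v_abs i.
have vi : v i = `|v i|.
  apply/esym/eqP; rewrite -subr_eq0; apply/eqP; apply: v_abs.
  - by move=> k; rewrite subr_ge0 ler_norm.
  - move=> k; rewrite [in LHS]absP [in LHS](vP k) -sumrB.
    by apply: eq_bigr => l _; rewrite mulrBl.
  - by rewrite gtr0_norm// subrr.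
rewrite lt_neqAle [v i]vi normr_ge0 andbT eq_sym normr_eq0 -normr_eq0.
apply/eqP => v0; have := @invariant_ge0_eq0 (fun j => `|v j|) i.
by move=> /(_ (fun=> normr_ge0 _) absP v0 i0)/normr0_eq0; apply/eqP; rewrite gt_eqF.
Qed.

(** * Randomized skipping with acceptance probabilities [alpha] *)

Variable alpha : 'I_J.+1 -> R.
Hypotheses (a01 : forall i, 0 <= alpha i <= 1) (a0 : alpha ord0 = 1).

Let D : 'M[R]_J.+1 := diag_mx (\row_i (1 - alpha i)).
Let A : 'M[R]_J.+1 := diag_mx (\row_i alpha i).

(* Minimum principle: a negative minimum of [v] would propagate along the
   positive entries of [P], through nodes with [alpha = 0] only, up to node 0. *)
Lemma skip_kernel_min (v : 'I_J.+1 -> R) :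
  (forall i, \sum_k P i k * (1 - alpha k) * v k <= v i) -> forall i, 0 <= v i.
Proof.
move=> vP.
have [i1 _ vmin] : exists2 i1, true & forall i, v i1 <= v i.
  by case: (Order.TotalTheory.arg_minP v (i0 := ord0) (P := xpredT)) => // i _ vi;
    exists i => // k; exact: vi.
suff vi1 : 0 <= v i1 by move=> i; apply: le_trans (vmin i).
rewrite leNgt; apply/negP => v_lt0.
(* The factor [1 - alpha k] lies in [0,1], so it can only raise the negative minimum. *)
have terms i k : v i1 * P i k <= P i k * (1 - alpha k) * v k.
  have /andP[al0 al1] := a01 k.
  rewrite mulrC -mulrA ler_wpM2l ?P_st.1//.
  apply: (@le_trans _ _ ((1 - alpha k) * v i1)).
    by rewrite -[leLHS]mul1r ler_wnM2r ?(ltW v_lt0)// gerBl.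
  by rewrite ler_wpM2l// subr_ge0.
(* Where the minimum is attained, the row inequality is an equality, hence an equality term by term:
   [(1 - alpha l) * v l = v i1]. *)
have step k l : v k = v i1 -> 0 < P k l -> v l = v i1 /\ alpha l = 0.
  move=> vk Pkl.
  have tot : \sum_l (P k l * (1 - alpha l) * v l - v i1 * P k l) = 0.
    apply/eqP; rewrite eq_le sumr_ge0 ?andbT; last first.
      by move=> ? _; rewrite subr_ge0 terms.
    by rewrite sumrB -mulr_sumr P_st.2 mulr1 subr_le0 -vk vP.
  have /eqP : P k l * (1 - alpha l) * v l - v i1 * P k l = 0.
    by apply: (psumr_eq0P _ tot) => // i _; rewrite subr_ge0 terms.
  rewrite (mulrC (v i1)) -mulrA -mulrBr mulf_eq0 gt_eqF//= subr_eq0 => /eqP vl.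
  have /andP[al0 al1] := a01 l.
  have vl0 : v l < 0.
    rewrite ltNge; apply/negP => vl0.
    by move: v_lt0; rewrite -vl ltNge mulr_ge0// subr_ge0.
  have vll : v l = v i1.
    apply/eqP; rewrite eq_le vmin andbT -vl -[leLHS]mul1r.
    by rewrite ler_wnM2r ?(ltW vl0)// gerBl.
  split=> //; move/eqP: vl; rewrite vll mulrBl mul1r -subr_eq0 addrAC subrr add0r.
  by rewrite oppr_eq0 mulf_eq0 (lt_eqF v_lt0) orbF => /eqP.
have all_min : forall k, v k = v i1.
  by apply: (irreducible_closed (i := i1)) => // k l vk /(step k l vk)[].
(* [step] gives [alpha = 0] only at the target of an entry, so one entry out of [i1] is followed
   before propagating. *)
have : \sum_k P i1 k <> 0 by rewrite P_st.2; apply/eqP/oner_neq0.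
move=> /psumr_neq0P[k _|k /andP[_ Pk]]; first exact: P_st.1.
pose S k := v k = v i1 /\ alpha k = 0.
have : S ord0.
  apply: (irreducible_closed (S := S) (i := k)).
    exact: step Pk.
  by move=> i l [vi _]; exact: step.
by case=> _; rewrite a0 => /eqP; rewrite oner_eq0.
Qed.

Lemma mul_mx_skipE (v : 'cV[R]_J.+1) i :
  ((1%:M - P *m D) *m v) i ord0
  = v i ord0 - \sum_k P i k * (1 - alpha k) * v k ord0.
Proof.
rewrite mulmxBl mul1mx !mxE; congr (_ - _); apply: eq_bigr => k _.
by rewrite mul_mx_diag !mxE.
Qed.

Lemma skip_kernel_ge0 (v : 'cV[R]_J.+1) :
  (forall i, 0 <= ((1%:M - P *m D) *m v) i ord0) -> forall i, 0 <= v i ord0.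
Proof.
move=> v0; apply: skip_kernel_min => i.
by have := v0 i; rewrite mul_mx_skipE subr_ge0.
Qed.

(** A kernel vector and its opposite are both nonnegative by the minimum principle, so the kernel is
    trivial. *)
Lemma skip_unitmx : 1%:M - P *m D \in unitmx.
Proof.
have ker0 (v : 'cV[R]_J.+1) : (1%:M - P *m D) *m v = 0 -> v = 0.
  move=> v0; apply/colP => i; rewrite mxE; apply/eqP; rewrite eq_le -oppr_ge0.
  have := @skip_kernel_ge0 (- v) _ i; rewrite mxE => -> /=; last first.
    by move=> k; rewrite mulmxN v0 oppr0 mxE.
  by apply: skip_kernel_ge0 => k; rewrite v0 mxE.
rewrite -unitmx_tr -row_free_unit; apply/inj_row_free => v v0.
apply: trmx_inj; rewrite trmx0; apply: ker0; apply: trmx_inj.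
by rewrite trmx_mul trmxK v0 trmx0.
Qed.

Lemma skip_eq : (1%:M - P *m D) *m skip P alpha = P *m A.
Proof. by rewrite /skip -mulmxA mulKVmx// skip_unitmx. Qed.

Lemma skip_ge0 i j : 0 <= skip P alpha i j.
Proof.
have := @skip_kernel_ge0 (col j (skip P alpha)) _ i; rewrite mxE; apply => k.
rewrite colE mulmxA skip_eq -colE mxE mul_mx_diag !mxE mulr_ge0 ?P_st.1//.
by have /andP[] := a01 j.
Qed.

(** Decomposition by the first proposal: [j] is accepted at once, or a proposal [k] is rejected and
    the search restarts from row [k]. *)
Lemma skipE i j :
  skip P alpha i j = P i j * alpha j + \sum_k P i k * (1 - alpha k) * skip P alpha k j.
Proof.
have := mul_mx_skipE (col j (skip P alpha)) i.
rewrite colE mulmxA skip_eq -!colE mxE mul_mx_diag !mxE => /eqP.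
by rewrite eq_sym subr_eq => /eqP ->; under eq_bigr do rewrite mxE.
Qed.

(** Acceptance of the first proposal alone gives the bound; it transfers positive entries of [P] to
    the skipping matrix when [alpha] is positive. *)
Lemma skip_ge i j : P i j * alpha j <= skip P alpha i j.
Proof.
rewrite skipE lerDl sumr_ge0// => k _; rewrite mulr_ge0 ?skip_ge0//.
by rewrite mulr_ge0 ?P_st.1// subr_ge0; have /andP[] := a01 k.
Qed.

Lemma skip_col0 i j : alpha j = 0 -> skip P alpha i j = 0.
Proof. by move=> aj; rewrite /skip mul_mx_diag !mxE aj mulr0. Qed.

Lemma skip_stochastic : stochastic (skip P alpha).
Proof.
split=> [|i]; first exact: skip_ge0.
pose e : 'cV[R]_J.+1 := const_mx 1.
suff /(congr1 (fun v : 'cV[R]_J.+1 => v i ord0)) : skip P alpha *m e = e.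
  rewrite mxE [e _ _]mxE => <-.
  by apply: eq_bigr => k _; rewrite [e _ _]mxE mulr1.
(* After multiplication by the invertible matrix, the claim is [P A e = e - P D e], which is
   [P e = e] since [A + D] is the identity. *)
apply: (can_inj (mulKmx skip_unitmx)); rewrite mulmxA skip_eq; apply/colP => k.
rewrite mul_mx_skipE !mxE -[X in X - _](P_st.2 k) -sumrB.
apply: eq_bigr => l _.
by rewrite mul_mx_diag !mxE !mulr1 mulrBr mulr1 opprB addrC subrK.
Qed.

Lemma skip_invariant (eta : 'I_J.+1 -> R) :
  (forall j, eta j = \sum_i eta i * P i j) ->
  forall j, alpha j * eta j = \sum_i alpha i * eta i * skip P alpha i j.
Proof.
move=> etaP j; pose e : 'rV[R]_J.+1 := \row_i eta i.
have eP : e *m P = e by apply/rowP => k; rewrite !mxE etaP; under eq_bigr do rewrite mxE.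
have eA : e *m A = e *m (1%:M - P *m D).
  rewrite mulmxBr mulmx1 mulmxA eP; apply/rowP => k.
  by rewrite !mul_mx_diag !mxE mulrBr mulr1 opprB addrC subrK.
have : e *m A *m skip P alpha = e *m A by rewrite eA -mulmxA skip_eq mulmxA eP.
move=> /(congr1 (fun v : 'rV[R]_J.+1 => v ord0 j)).
rewrite mul_mx_diag [in RHS]mxE !mxE mulrC => <-.
by apply: eq_bigr => k _; rewrite !mxE [eta k * _]mulrC.
Qed.

End IrreducibleMatrix.

(** * Recurrence from small stationary flows *)

Section Esum.
Variable R : realType.
Local Open Scope ereal_scope.

Lemma esumZl (T : choiceType) (D : set T) (c : R) (a : T -> \bar R) :
  (0 <= c)%R -> (forall i, 0 <= a i) ->
  \esum_(i in D) (c%:E * a i) = c%:E * \esum_(i in D) a i.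
Proof.
move=> c0 a0; rewrite /esum -ereal_supZl//; last first.
  by apply/set0P; exists (\sum_(x \in set0) a x); exists set0; first exact: fsets_set0.
rewrite image_comp; congr ereal_sup; apply: eq_imagel => F _ /=.
by rewrite ge0_mule_fsumr.
Qed.

Lemma exchange_esum (T1 T2 : choiceType) (I : set T1) (K : set T2)
    (a : T1 -> T2 -> \bar R) : (forall i j, 0 <= a i j) ->
  \esum_(i in I) \esum_(j in K) a i j = \esum_(j in K) \esum_(i in I) a i j.
Proof.
move=> a0; rewrite !esum_esum//.
rewrite (reindex_esum (K `*`` (fun=> I)) _ (fun x => (x.2, x.1)))//.
split=> [[x y] []//|[x y] [x' y'] _ _ [-> ->]//|[x y] [/= Ix Ky]].
by exists (y, x).
Qed.

Lemma esum_point (T : choiceType) (D : set T) (z : T) (a : T -> \bar R) :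
  D z -> 0 <= a z -> (forall y, y != z -> a y = 0) -> \esum_(y in D) a y = a z.
Proof.
move=> Dz az a0; rewrite (esumID [set z]); last first.
  by move=> y _; have [->//|/a0->] := eqVneq y z.
rewrite setIC (_ : [set z] `&` D = [set z]); last by apply/seteqP; split=> y [->]//.
by rewrite esum_set1// esum1 ?adde0// => y [_ /= /eqP /a0].
Qed.

Lemma esum_le_term (T : choiceType) (D : set T) (a : T -> \bar R) z :
  D z -> a z <= \esum_(y in D) a y.
Proof.
move=> Dz; apply: esum_ge; exists [set z]; last by rewrite fsbig_set1.
by split=> [|_ ->]//; exact: finite_set1.
Qed.

Lemma esum_succ (a : nat -> \bar R) : (forall n, 0 <= a n) ->
  \esum_(n in [set: nat]) a n = a 0%N + \esum_(n in [set: nat]) a n.+1.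
Proof.
move=> a0; rewrite (esumID [set 0%N])// setTI esum_set1//; congr (_ + _).
rewrite -(esum_image [set: nat] S); last by move=> ? ? _ _ [].
congr esum; apply/seteqP; split=> [[|n]|n] /=.
- by case.
- by move=> _; exists n.
- by case=> m _ <-; split.
Qed.

End Esum.

(** * Hitting probabilities of the jump chain and escape flow *)

Section Recurrence.
Variables (R : realType) (S : choiceType) (q : S -> S -> R).
Hypotheses (q_ge0 : forall x y, 0 <= q x y) (q_stable : stable q).
Local Open Scope ereal_scope.

Let c x := fine (qout q x).

Let qout_ge0 x : 0 <= qout q x.
Proof. by apply: esum_ge0 => y _; rewrite lee_fin. Qed.

Let qoutE x : qout q x = (c x)%:E.
Proof. by rewrite /c fineK// ge0_fin_numE// q_stable. Qed.

Let c_ge0 x : (0 <= c x)%R. Proof. exact: fine_ge0. Qed.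

Lemma rate_le_qout x y : y != x -> (q x y)%:E <= qout q x.
Proof. by move=> yx; apply: (esum_le_term (fun y => (q x y)%:E)). Qed.

Lemma jump_ge0 x y : (0 <= jump q x y)%R.
Proof.
rewrite /jump; case: eqP => _; first by case: ifP.
by rewrite divr_ge0// fine_ge0.
Qed.

Let Ejump_ge0 x y : 0 <= (jump q x y)%:E.
Proof. by rewrite lee_fin jump_ge0. Qed.
Hint Resolve Ejump_ge0 : core.

Let offdiag (x : S) : ~` [set x] = [set y | y != x].
Proof. by apply/seteqP; split=> y /eqP. Qed.

(** Translates jump probabilities into rates. The factor [c x] covers absorbing states, where both
    sides vanish; otherwise the diagonal jump probability is 0. *)
Lemma esum_jump x (h : S -> \bar R) : (forall y, 0 <= h y) ->
  (c x)%:E * (\esum_(y in [set: S]) ((jump q x y)%:E * h y))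
  = \esum_(y in [set y | y != x]) ((q x y)%:E * h y).
Proof.
move=> h0; have [cx0|cx0] := eqVneq (c x) 0%R.
  rewrite cx0 mul0e esum1// => y /= yx.
  have := rate_le_qout yx; rewrite qoutE cx0 lee_fin => qxy.
  by rewrite (_ : q x y = 0%R) ?mul0e//; apply/eqP; rewrite eq_le qxy q_ge0.
rewrite -esumZl//; last by move=> y; rewrite mule_ge0.
have term_ge0 y : 0 <= (c x)%:E * ((jump q x y)%:E * h y).
  by rewrite mule_ge0 ?lee_fin// mule_ge0.
rewrite (esumID [set x])// !setTI esum_set1//.
rewrite {1}/jump eqxx -/(c x) (negbTE cx0) mul0e mule0 add0e offdiag.
apply: eq_esum => y /= yx.
by rewrite /jump (negbTE yx) -/(c x) muleA -EFinM mulrCA divff// mulr1.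
Qed.

Lemma jump_mass x : \esum_(y in [set: S]) (jump q x y)%:E = 1.
Proof.
have [cx0|cx0] := eqVneq (c x) 0%R.
  rewrite (esum_point (z := x))//; first by rewrite /jump eqxx -/(c x) cx0 eqxx.
  by move=> y yx; rewrite /jump (negbTE yx) -/(c x) cx0 invr0 mulr0.
have := @esum_jump x (fun=> 1) (fun=> lee01).
under eq_esum do rewrite mule1.
under [RHS]eq_esum do rewrite mule1.
rewrite -/(qout q x) qoutE => cE.
have : (c x)^-1%:E * ((c x)%:E * (\esum_(y in [set: S]) (jump q x y)%:E)) = 1.
  by rewrite cE -EFinM mulVf.
by rewrite muleA -EFinM mulVf// mul1e.
Qed.

Variable o : S.

Lemma fpass_ge0 n x : 0 <= fpass q o n x.
Proof.
elim: n x => [|n IH] x //=; apply: adde_ge0; first by case: n {IH}.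
by apply: esum_ge0 => y _; rewrite mule_ge0.
Qed.
Hint Resolve fpass_ge0 : core.

(** First-step decomposition: a jump to [o] counts once, and a jump elsewhere continues with a sum
    that is at most 1 by induction. *)
Lemma fpass_sum_le1 N x : \sum_(n < N) fpass q o n x <= 1.
Proof.
elim: N x => [|N IH] x; first by rewrite big_ord0 lee01.
rewrite big_ord_recl add0e.
under eq_bigr do rewrite lift0 /=.
rewrite big_split/= -(jump_mass x) (esumID [set o])// setTI esum_set1// setTI offdiag.
apply: leeD.
  case: N {IH} => [|N]; first by rewrite big_ord0.
  by rewrite big_ord_recl big1 ?adde0.
rewrite -esum_sum => [|y n _ _]; last by rewrite mule_ge0.
apply: le_esum => y _; rewrite -ge0_sume_distrr//.
by rewrite -[leRHS]mule1 lee_wpmul2l.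
Qed.

(** Time 0 does not count, so [hit o] is the return probability. *)
Definition hit x := \esum_(n in [set: nat]) fpass q o n x.

Lemma hit_ge0 x : 0 <= hit x. Proof. by apply: esum_ge0. Qed.
Hint Resolve hit_ge0 : core.

Lemma hit_le1 x : hit x <= 1.
Proof.
rewrite /hit -nneseries_esumT//; apply: lime_le.
  by apply: is_cvg_nneseries.
by apply: nearW => N; rewrite big_mkord fpass_sum_le1.
Qed.

Lemma hit_step x :
  hit x = (jump q x o)%:E + \esum_(y in [set y | y != o]) ((jump q x y)%:E * hit y).
Proof.
rewrite /hit esum_succ// add0e /= esumD; [|by case|]; last first.
  by move=> n _; apply: esum_ge0 => y _; rewrite mule_ge0.
congr (_ + _); first by rewrite (esum_point (z := 0%N))// => -[].
rewrite exchange_esum//; last by move=> n y; rewrite mule_ge0.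
by apply: eq_esum => y _; rewrite esumZl// jump_ge0.
Qed.

(** Here time 0 does count: [u o = 1], and the escape probability [d] vanishes at [o]. The gap
    between [u o] and [hit o] is what the flow argument measures. *)
Let u x : R := if x == o then 1%R else fine (hit x).
Let d x : R := (1 - u x)%R.

Let hitK x : (fine (hit x))%:E = hit x.
Proof. by rewrite fineK// ge0_fin_numE// (le_lt_trans (hit_le1 x)) ?ltry. Qed.

Let hit01 x : (0 <= fine (hit x) <= 1)%R.
Proof. by rewrite fine_ge0//= -lee_fin hitK hit_le1. Qed.

Let u_ge0 x : (0 <= u x)%R.
Proof. by rewrite /u; case: ifP => // _; case/andP: (hit01 x). Qed.

Let d_ge0 x : (0 <= d x)%R.
Proof. by rewrite subr_ge0 /u; case: ifP => // _; case/andP: (hit01 x). Qed.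

Let d_le1 x : (d x <= 1)%R. Proof. by rewrite gerBl. Qed.

Let escape_step x :
  \esum_(y in [set y | y != x]) (q x y * d y)%:E = (c x * (1 - fine (hit x)))%:E.
Proof.
have hitE : hit x = \esum_(y in [set: S]) ((jump q x y)%:E * (u y)%:E).
  have term_ge0 y : 0 <= (jump q x y)%:E * (u y)%:E by rewrite mule_ge0// lee_fin.
  rewrite hit_step [RHS](esumID [set o])// !setTI esum_set1// /u eqxx mule1 offdiag.
  by congr (_ + _); apply: eq_esum => y /= yo; rewrite (negbTE yo) hitK.
have := @esum_jump x (fun y => (u y)%:E) u_ge0; rewrite -hitE -hitK -EFinM.
under eq_esum do rewrite -EFinM.
move=> qu; have := qoutE x; rewrite /qout.
have qE y : (q x y)%:E = (q x y * d y)%:E + (q x y * u y)%:E.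
  by rewrite -EFinD -mulrDr subrK mulr1.
under eq_esum do rewrite qE.
rewrite esumD; [|by move=> y _; rewrite lee_fin mulr_ge0..].
rewrite -qu mulrBr mulr1 EFinB => <-.
by rewrite addeK.
Qed.

(* Global balance tested against the function [d] restricted to [A]: the flow
   of the stationary chain out of [A] dominates the rate of excursions from
   [o] that never come back. *)
Lemma escape_le_flux (pi : S -> R) (A : set S) :
  stationary q pi -> finite_set A -> A o ->
  (pi o * (c o * (1 - fine (hit o))))%:E
  <= \esum_(x in A) \esum_(y in ~` A) (pi x * q x y)%:E.
Proof.
move=> [pi_ge0 _ balance] finA Ao.
(* Stationary flow weighted by the escape probability of its target. Row sums come from
   [escape_step], column sums from global balance. *)
pose F x y := if y == x then 0 else (pi x * q x y * d y)%:E.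
have F_ge0 x y : 0 <= F x y.
  by rewrite /F; case: ifP => // _; rewrite lee_fin !mulr_ge0.
pose T := \esum_(x in A) (pi x * (c x * d x))%:E.
have T_fin : T \is a fin_num.
  rewrite /T esum_fset//; last by move=> x _; rewrite lee_fin !mulr_ge0.
  by rewrite fsumEFin.
have outE x : (pi x * (c x * (1 - fine (hit x))))%:E = \esum_(y in [set: S]) F x y.
  rewrite EFinM -escape_step -esumZl//; last by move=> y; rewrite lee_fin mulr_ge0.
  rewrite [LHS]esum_mkcond; apply: eq_esum => y _; rewrite /F.
  have [->|yx] := eqVneq y x; first by rewrite memNset//= eqxx.
  by rewrite mem_set//= -EFinM mulrA.
have inE y : \esum_(x in [set: S]) F x y = (pi y * (c y * d y))%:E.
  rewrite mulrA mulrC EFinM (EFinM (pi y)) -qoutE -(esumZl _ (pi_ge0 y))//; last first.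
    by move=> x; rewrite lee_fin.
  under [in RHS]eq_esum do rewrite -EFinM.
  rewrite -balance -esumZl//; last by move=> x; rewrite lee_fin mulr_ge0.
  rewrite [RHS]esum_mkcond; apply: eq_esum => x _; rewrite /F eq_sym.
  have [->|yx] := eqVneq x y; first by rewrite memNset//= eqxx.
  by rewrite mem_set//= -EFinM mulrC.
(* [T] is finite because [A] is, so it may be added to both sides. The row sums over [A] exceed [T]
   only at [o], where [d o = 0]. *)
rewrite -(leeD2lE _ _ T_fin).
have -> : T + (pi o * (c o * (1 - fine (hit o))))%:E
          = \esum_(x in A) \esum_(y in [set: S]) F x y.
  under eq_esum do rewrite -outE.
  pose k x := if x == o then (pi o * (c o * (1 - fine (hit o))))%:E else 0.
  have hit0 : (0 <= pi o * (c o * (1 - fine (hit o))))%R.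
    by rewrite !mulr_ge0// subr_ge0; case/andP: (hit01 o).
  have -> : (pi o * (c o * (1 - fine (hit o))))%:E = \esum_(x in A) k x.
    rewrite (esum_point (z := o))// /k ?eqxx//.
    by move=> y /negbTE ->.
  rewrite -esumD => [|x _|x _]; last 2 first.
  - by rewrite lee_fin !mulr_ge0.
  - by rewrite /k; case: ifP.
  apply: eq_esum => x _; rewrite /k /d /u; case: eqP => [->|_].
    by rewrite subrr !mulr0 add0e.
  by rewrite adde0.
(* Flow staying in [A] is at most the column sums over [A], which total [T]; flow leaving [A] is
   bounded using [d <= 1]. *)
under eq_esum do rewrite (esumID A)// !setTI.
rewrite esumD; [|by move=> x _; exact: esum_ge0..].
apply: leeD.
  rewrite exchange_esum//; apply: le_esum => y _; rewrite -inE.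
  by rewrite [leLHS]esum_mkcond; apply: le_esum => x _; case: ifP.
apply: le_esum => x _; apply: le_esum => y _; rewrite /F; case: ifP => _.
  by rewrite lee_fin mulr_ge0.
by rewrite lee_fin ler_piMr// mulr_ge0.
Qed.

End Recurrence.

(** A return probability below 1 would bound the flow out of every finite set around [o] below by
    one positive constant [e], against a set with flow at most [e / 2]. *)
Lemma jump_recurrent_of_flux (R : realType) (S : choiceType) (q : S -> S -> R)
    (pi : S -> R) :
  (forall x y, 0 <= q x y) -> stable q -> stationary q pi ->
  (forall x, 0 < pi x) -> (forall x, exists y, qstep q x y) ->
  (forall o (e : R), 0 < e -> exists2 A : set S, finite_set A /\ A o &
     (\esum_(x in A) \esum_(y in ~` A) (pi x * q x y)%:E <= e%:E)%E) ->
  jump_recurrent q.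
Proof.
move=> q_ge0 q_stable pi_st pi_gt0 q_step flux o; apply/eqP.
rewrite eq_le hit_le1//= leNgt; apply/negP => hit_lt1.
have hit_fin : (hit q o o) \is a fin_num.
  by rewrite ge0_fin_numE ?hit_ge0// (lt_trans hit_lt1) ?ltry.
have c_gt0 : 0 < fine (qout q o).
  have [y [/eqP oy qy]] := q_step o; rewrite -lte_fin fineK.
    by rewrite (lt_le_trans _ (rate_le_qout _ _ (y := y)))// ?lte_fin// eq_sym.
  by rewrite ge0_fin_numE ?q_stable// esum_ge0// => ? _; rewrite lee_fin.
set e := pi o * (fine (qout q o) * (1 - fine (hit q o o))).
have e_gt0 : 0 < e.
  by rewrite !mulr_gt0// subr_gt0 -lte_fin fineK.
have [A [finA Ao]] := flux o (e / 2) (divr_gt0 e_gt0 (ltr0Sn _ 1)).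
rewrite leNgt => /negP; apply.
apply: lt_le_trans (escape_le_flux q_ge0 q_stable pi_st finA Ao).
by rewrite lte_fin ltr_pdivrMr// ltr_pMr// ltr1n.
Qed.

(** * Jackson networks *)

Section Moves.
Variables (R : realType) (J : nat).
Implicit Types (n m : state J) (i j : 'I_J.+1) (k : 'I_J).

(* Nodes range over the extended set: [addc n ord0 = remc n ord0 = n], so that
   arrivals, departures and internal transfers are all moves
   [n |-> addc (remc n j) i] of one customer from node [j] to node [i]. *)
Definition addc n i : state J := [ffun k => (n k + (ext k == i))%N].
Definition remc n j : state J := [ffun k => (n k - (ext k == j))%N].
Definition occupied n j := if unlift ord0 j is Some k then (0 < n k)%N else true.

Lemma ext_eq k k' : (ext k == ext k') = (k == k').
Proof. exact: (inj_eq lift_inj). Qed.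

Lemma ext_eq0 k : (ext k == ord0) = false.
Proof. by apply/negbTE; rewrite eq_sym; apply: neq_lift. Qed.

Lemma occupied0 n : occupied n ord0.
Proof. by rewrite /occupied unlift_none. Qed.

Lemma occupied_ext n k : occupied n (ext k) = (0 < n k)%N.
Proof. by rewrite /occupied liftK. Qed.

Lemma addc0 n : addc n ord0 = n.
Proof. by apply/ffunP => k; rewrite ffunE ext_eq0 addn0. Qed.

Lemma remc0 n : remc n ord0 = n.
Proof. by apply/ffunP => k; rewrite ffunE ext_eq0 subn0. Qed.

Lemma addcK n i : remc (addc n i) i = n.
Proof. by apply/ffunP => k; rewrite !ffunE addnK. Qed.

Lemma remcK n j : occupied n j -> addc (remc n j) j = n.
Proof.
case: (unliftP ord0 j) => [k ->|-> _]; last by rewrite remc0 addc0.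
rewrite -/(ext k) occupied_ext => nk; apply/ffunP => k'; rewrite !ffunE ext_eq.
by case: eqP => [->|_]; rewrite ?subn0 ?addn0// subnK.
Qed.

Lemma occupied_addc n i : occupied (addc n i) i.
Proof.
case: (unliftP ord0 i) => [k ->|->]; last exact: occupied0.
by rewrite -/(ext k) occupied_ext ffunE eqxx addn1.
Qed.

Lemma addc_inj n : injective (addc n).
Proof.
move=> i j ij.
have eq_ext k : (ext k == i) = (ext k == j).
  have := congr1 (fun n' : state J => n' k) ij.
  by rewrite !ffunE => /addnI; do 2 case: eqP.
case: (unliftP ord0 i) eq_ext => [k ->|->] eq_ext.
  by have := eq_ext k; rewrite eqxx => /esym/eqP.
case: (unliftP ord0 j) eq_ext => [k ->|-> //] eq_ext.
by have := eq_ext k; rewrite -/(ext k) eqxx ext_eq0.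
Qed.

Variables (l : R) (s : 'I_J -> nat -> R) (P : 'M[R]_J.+1).

(** The external source is a server that is never idle and has intensity [l]. *)
Definition service n j : R :=
  if unlift ord0 j is Some k then (0 < n k)%:R * s k (n k) else l.

Lemma service0 n : service n ord0 = l.
Proof. by rewrite /service unlift_none. Qed.

Lemma service_ext n k : service n (ext k) = (0 < n k)%:R * s k (n k).
Proof. by rewrite /service liftK. Qed.

Lemma service_occupied n j : service n j != 0 -> occupied n j.
Proof.
by rewrite /service /occupied; case: unlift => // k; case: (0 < n k)%N; rewrite ?mul0r ?eqxx.
Qed.

Definition rate := jackson_rate (fun k => l * P ord0 (ext k)) s P.

Lemma rateE n m :
  rate n m = \sum_j \sum_(i | i != j)
     (m == addc (remc n j) i)%:R * (service n j * P j i).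
Proof.
have plusE n' k : plus_e n' k = addc n' (ext k).
  by apply/ffunP => k'; rewrite !ffunE ?ext_eq.
have minusE k : minus_e n k = remc n (ext k).
  by apply/ffunP => k'; rewrite !ffunE ?ext_eq.
rewrite big_ord_recl /rate /jackson_rate -addrA; congr (_ + _).
  rewrite [RHS]big_mkcond big_ord_recl eqxx /= add0r; apply: eq_bigr => k _.
  by rewrite -/(ext k) ?ext_eq0 service0 remc0 plusE; ring.
rewrite -big_split/=; apply: eq_bigr => k _.
rewrite [RHS]big_mkcond big_ord_recl neq_lift [LHS]addrC -/(ext k).
congr (_ + _).
  by rewrite addc0 service_ext minusE -mulnb natrM; ring.
rewrite big_mkcond; apply: eq_bigr => k' _; rewrite -/(ext k') ext_eq.
by case: eqP => //= _; rewrite service_ext plusE minusE -mulnb natrM; ring.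
Qed.

Hypotheses (l_ge0 : 0 <= l) (s_ge0 : forall k x, (0 < x)%N -> 0 <= s k x) (P_st : stochastic P).

Lemma service_ge0 n j : 0 <= service n j.
Proof.
rewrite /service; case: unlift => // k; case: posnP => [|nk]; first by rewrite mul0r.
by rewrite mul1r s_ge0.
Qed.

Lemma move_rate_ge0 n j i : 0 <= service n j * P j i.
Proof. by rewrite mulr_ge0 ?service_ge0// P_st.1. Qed.

Lemma rate_ge0 n m : 0 <= rate n m.
Proof.
by rewrite rateE; do 2 (apply: sumr_ge0 => ? _); rewrite mulr_ge0// move_rate_ge0.
Qed.

Lemma move_neq n j i : i != j -> occupied n j -> addc (remc n j) i != n.
Proof.
by move=> ij nj; apply: contraNneq ij; rewrite -{2}(remcK nj) => /addc_inj ->.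
Qed.

Lemma row_off_diag j : \sum_(i | i != j) P j i = 1 - P j j.
Proof. by rewrite -(P_st.2 j) [in RHS](bigD1 j)//= addrAC subrr add0r. Qed.

Lemma qout_rate n : qout rate n = (\sum_j service n j * (1 - P j j))%:E.
Proof.
rewrite /qout; under eq_esum do rewrite rateE -sumEFin.
rewrite esum_sum; last first.
  by move=> ? ? _ _; rewrite lee_fin; apply: sumr_ge0 => ? _; rewrite mulr_ge0// move_rate_ge0.
rewrite -sumEFin; apply: eq_bigr => j _; rewrite -row_off_diag mulr_sumr -sumEFin.
under eq_esum do rewrite -sumEFin.
rewrite esum_sum; last by move=> ? ? _ _; rewrite lee_fin mulr_ge0// move_rate_ge0.
apply: eq_bigr => i ij.
(* At an empty node [remc] truncates and names a wrong target, but the service factor is then 0. *)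
have [s0|/service_occupied nj] := eqVneq (service n j) 0.
  by rewrite s0 mul0r esum1// => m _; rewrite mulr0.
rewrite (esum_point (z := addc (remc n j) i)) /=.
- by rewrite eqxx mul1r.
- exact: move_neq.
- by rewrite lee_fin mulr_ge0// move_rate_ge0.
- by move=> m /negbTE ->; rewrite mul0r.
Qed.

Lemma stable_rate : stable rate.
Proof. by move=> n; rewrite qout_rate ltry. Qed.

Lemma qstep_move n j i : i != j -> 0 < service (addc n j) j -> 0 < P j i ->
  qstep rate (addc n j) (addc n i).
Proof.
move=> ij sj Pji; split; first by move=> /addc_inj /esym/eqP; rewrite (negbTE ij).
rewrite rateE (bigD1 j)//= ltr_pwDl ?sumr_ge0//; last first.
  by move=> ? _; apply: sumr_ge0 => ? _; rewrite mulr_ge0// move_rate_ge0.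
rewrite (bigD1 i)//= addcK eqxx mul1r ltr_pwDl ?mulr_gt0// sumr_ge0// => ? _.
by rewrite mulr_ge0// move_rate_ge0.
Qed.

Lemma qstep_moveP n m : qstep rate n m -> exists j i,
  [/\ m = addc (remc n j) i, service n j != 0 & P j i != 0].
Proof.
case=> _; rewrite rateE => /lt0r_neq0/eqP/psumr_neq0P.
case=> [j _|j /andP[_]]; first by apply: sumr_ge0 => ? _; rewrite mulr_ge0// move_rate_ge0.
move=> /lt0r_neq0/eqP/psumr_neq0P.
case=> [i _|i /andP[ij]]; first by rewrite mulr_ge0// move_rate_ge0.
move=> /lt0r_neq0; rewrite !mulf_eq0 !negb_or => /and3P[mE sj Pji].
by exists j, i; split=> //; apply/eqP; apply: contraNT mE => /negbTE ->; exact: eqxx.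
Qed.

Section Balance.
Variables (pi : state J -> R) (theta : 'I_J.+1 -> R).
Hypotheses (pi_ge0 : forall n, 0 <= pi n)
  (theta_inv : forall i, theta i = \sum_j theta j * P j i)
  (pi_addc : forall n j, pi (addc n j) * service (addc n j) j = theta j * pi n).

Let p n i := (occupied n i)%:R * pi (remc n i).

Let pi_service n i : pi n * service n i = theta i * p n i.
Proof.
rewrite /p; have [ni|ni] := boolP (occupied n i).
  by rewrite -{1 2}(remcK ni) pi_addc mul1r.
have [->|/service_occupied] := eqVneq (service n i) 0.
  by rewrite mulr0 mul0r mulr0.
by rewrite (negbTE ni).
Qed.

(* The only state from which a move [j -> i] leads to [n] is
   [addc (remc n i) j], and only if [n] is occupied at [i]. *)
Let in_move n i j : i != j ->
  \esum_(m in [set m | m != n])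
    (pi m * ((n == addc (remc m j) i)%:R * (service m j * P j i)))%:E
  = (p n i * (theta j * P j i))%:E.
Proof.
move=> ij.
have term0 m : ~ (n = addc (remc m j) i /\ occupied m j) ->
    (pi m * ((n == addc (remc m j) i)%:R * (service m j * P j i)))%:E = 0%E.
  move=> H; case: eqP => [nE|_]; last by rewrite mul0r mulr0.
  have [->|/service_occupied mj] := eqVneq (service m j) 0; last by case: H.
  by rewrite mul0r !mulr0.
have [ni|ni] := boolP (occupied n i); last first.
  rewrite /p (negbTE ni) !mul0r esum1// => m _; apply: term0 => -[nE _].
  by move: ni; rewrite nE occupied_addc.
rewrite (esum_point (z := addc (remc n i) j)) /=.
- rewrite addcK (remcK ni) eqxx mul1r mulrA pi_addc /p ni mul1r.
  by congr (_%:E); ring.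
- by apply: contraNneq ij; rewrite -{2}(remcK ni) => /addc_inj ->.
- by rewrite lee_fin mulr_ge0// mulr_ge0// move_rate_ge0.
- move=> m /eqP mE; apply: term0 => -[nE mj]; apply: mE.
  by rewrite nE addcK remcK.
Qed.

(** Balance holds node by node: the flow into [n] by moves ending at [i] is
    [p n i * theta i * (1 - P i i)], which is also the flow out of [n] by moves starting at [i]. *)
Lemma rate_balance n :
  \esum_(m in [set m | m != n]) (pi m * rate m n)%:E
  = \esum_(m in [set m | m != n]) (pi n * rate n m)%:E.
Proof.
have term_ge0 i j m :
    0 <= pi m * ((n == addc (remc m j) i)%:R * (service m j * P j i)).
  by rewrite mulr_ge0// mulr_ge0// move_rate_ge0.
under [RHS]eq_esum do rewrite EFinM.
rewrite [RHS]esumZl//; last by move=> m; rewrite lee_fin rate_ge0.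
rewrite -/(qout rate n) qout_rate -EFinM mulr_sumr.
under eq_esum => m _ do (rewrite rateE mulr_sumr -sumEFin;
  under eq_bigr do rewrite mulr_sumr).
rewrite esum_sum; last by move=> ? ? _ _; rewrite lee_fin sumr_ge0.
under eq_bigr => j _.
  under eq_esum do rewrite -sumEFin.
  rewrite esum_sum; last by move=> ? ? _ _; rewrite lee_fin.
  under eq_bigr => i ij do rewrite in_move//.
  rewrite sumEFin.
  over.
rewrite sumEFin; congr (_%:E).
rewrite (exchange_big_dep predT)//=; apply: eq_bigr => i _.
under eq_bigl do rewrite eq_sym.
rewrite -mulr_sumr mulrA pi_service.
have := theta_inv i; rewrite (bigD1 i)//= => /eqP; rewrite addrC -subr_eq => /eqP <-.
by ring.
Qed.

Lemma stationary_rate :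
  \esum_(n in [set: state J]) (pi n)%:E = 1%E -> stationary rate pi.
Proof. by move=> pi1; split=> // n; exact: rate_balance. Qed.

End Balance.

End Moves.

(** * Irreducibility of the network process *)

Section Reachability.
Variables (R : realType) (J : nat).

Lemma closed_reach (S : choiceType) (q : S -> S -> R) (A : set S) x y :
  ctmc_closed q A -> A x -> clos_refl_trans S (qstep q) x y -> A y.
Proof.
move=> qA Ax xy; elim: xy Ax => [x' y' xy' Ax'|//|x' y' z' _ IH1 _ IH2 Ax'].
  exact: qA Ax' xy'.
exact/IH2/IH1.
Qed.

Variables (l : R) (s : 'I_J -> nat -> R) (P : 'M[R]_J.+1).
Hypotheses (l_gt0 : 0 < l) (s_gt0 : forall k x, (0 < x)%N -> 0 < s k x) (P_st : stochastic P).

(** Over a fixed base state one customer can travel along [r] between any two extended nodes.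
    Routing customers to or from node 0 one at a time connects every state with the empty one. *)
Lemma rate_irreducible (r : 'M[R]_J.+1) : stochastic r -> mx_irreducible r ->
  (forall i j, 0 < r i j -> 0 < P i j) -> ctmc_irreducible (rate l s P).
Proof.
move=> r_st r_irr rP.
pose reach := clos_refl_trans (state J) (qstep (rate l s P)).
have service_addc n i : 0 < service l s (addc n i) i.
  case: (unliftP ord0 i) => [k ->|->]; last by rewrite service0.
  by rewrite service_ext ffunE eqxx addn1 mul1r s_gt0.
have reach_move n i j : reach (addc n i) (addc n j).
  apply: (irreducible_closed r_st r_irr (S := fun j => reach (addc n i) (addc n j))
    (i := i)); first exact: rt_refl.
  move=> k k' ik rkk'; apply: rt_trans ik _.
  have [->|kk'] := eqVneq k k'; first exact: rt_refl.
  apply: rt_step; apply: qstep_move => //.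
  - exact: ltW.
  - by move=> *; exact/ltW/s_gt0.
  - by rewrite eq_sym.
  - exact: rP.
pose z : state J := [ffun=> 0%N].
have reach0 n : reach n z /\ reach z n.
  have [N] := ubnP (\sum_k n k)%N; elim: N n => // N IH n nN.
  have [n0|] := eqVneq (\sum_k n k)%N 0%N.
    suff -> : n = z by split; exact: rt_refl.
    apply/ffunP => k; rewrite ffunE; apply/eqP.
    by move/eqP: n0; rewrite sum_nat_eq0 => /forallP/(_ k).
  rewrite sum_nat_eq0 negb_forall => /existsP[k /= nk].
  have nE : addc (remc n (ext k)) (ext k) = n.
    by rewrite remcK// occupied_ext lt0n.
  have [|zr rz] := IH (remc n (ext k)).
    have : (\sum_k' n k' = (\sum_k' remc n (ext k) k').+1)%N.
      rewrite -{1}nE (bigD1 k)//= [in RHS](bigD1 k)//= ffunE eqxx addn1 addSn.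
      congr (_ + _).+1; apply: eq_bigr => k' k'k.
      by rewrite ffunE ext_eq (negbTE k'k) addn0.
    by move=> E; move: nN; rewrite E ltnS.
  split; [apply: rt_trans zr|apply: rt_trans rz _].
    by have := reach_move (remc n (ext k)) (ext k) ord0; rewrite addc0 nE.
  by have := reach_move (remc n (ext k)) ord0 (ext k); rewrite addc0 nE.
move=> n m; apply: rt_trans (reach0 n).1 (reach0 m).2.
Qed.

End Reachability.

(** * Flow across population levels and recurrence *)

Section LevelFlux.
Variables (R : realType) (J : nat).
Implicit Types (n m : state J).

Definition total n := (\sum_k n k)%N.

Lemma total_addc n i : total (addc n i) = (total n + (i != ord0))%N.
Proof.
rewrite /total; under eq_bigr do rewrite ffunE.
rewrite big_split/=; congr (_ + _)%N.
case: (unliftP ord0 i) => [k ->|->]; last first.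
  by rewrite eqxx big1// => k _; rewrite ext_eq0.
rewrite -/(ext k) ext_eq0 (bigD1 k)//= eqxx big1 ?addn0// => k' k'k.
by rewrite ext_eq (negbTE k'k).
Qed.

Lemma total_remc n j : occupied n j -> total n = (total (remc n j) + (j != ord0))%N.
Proof. by move=> nj; rewrite -{1}(remcK nj) total_addc. Qed.

Lemma finite_total_le N : finite_set [set n : state J | (total n <= N)%N].
Proof.
apply: (@sub_finite_set _ _
  ((fun g : {ffun 'I_J -> 'I_N.+1} => [ffun k => g k : nat] : state J) @` setT)).
  move=> n /= nN; have nkN k : (n k < N.+1)%N.
    by rewrite ltnS (leq_trans _ nN)// /total (bigD1 k)//= leq_addr.
  by exists [ffun k => Ordinal (nkN k)] => //; apply/ffunP => k; rewrite !ffunE.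
by apply: finite_image; exact: finite_finset.
Qed.

(** A finite set carries mass above [1 - e], and a level beyond all its populations is disjoint from
    it. *)
Lemma esum_level_small (pi : state J -> R) (e : R) (N0 : nat) :
  (forall n, 0 <= pi n) -> (\esum_(n in [set: state J]) (pi n)%:E = 1)%E -> 0 < e ->
  exists2 N, (N0 <= N)%N & (\esum_(n in [set n | total n = N]) (pi n)%:E <= e%:E)%E.
Proof.
move=> pi_ge0 pi1 e_gt0.
have pi_fin : (\esum_(n in [set: state J]) (pi n)%:E)%E \is a fin_num by rewrite pi1.
have [_ [F [finF _] <-]] := ub_ereal_sup_adherent e_gt0 pi_fin.
rewrite -/(esum _ _) pi1 -esum_fset//; last by move=> n _; rewrite lee_fin.
move=> Fe; have /finite_fsetP[X FX] := finF.
exists (maxn N0 (\max_(n <- X) total n).+1); first exact: leq_maxl.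
set L := [set n | _].
have LF : L `<=` ~` F.
  move=> n /= nL nF; have : (total n <= \max_(n <- X) total n)%N.
    by apply: leq_bigmax_seq => //; move: nF; rewrite FX.
  by rewrite nL leqNgt leq_maxr.
have F_fin : (\esum_(n in F) (pi n)%:E)%E \is a fin_num.
  rewrite ge0_fin_numE; last by apply: esum_ge0 => ? _; rewrite lee_fin.
  apply: (@le_lt_trans _ _ 1%E); last exact: ltry.
  by rewrite -pi1 [leLHS]esum_mkcond le_esum// => n _; case: ifP; rewrite ?lee_fin.
have : (\esum_(n in F) (pi n)%:E + \esum_(n in L) (pi n)%:E <= 1)%E.
  rewrite -pi1 [leRHS](esumID F); last by move=> ? _; rewrite lee_fin.
  rewrite !setTI leeD2l// [leLHS]esum_mkcond [leRHS]esum_mkcond le_esum// => n _.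
  case: ifPn => [/set_mem/LF nF|_]; first by rewrite mem_set.
  by case: ifP; rewrite ?lee_fin.
move=> le1; rewrite -(leeD2lE _ _ F_fin); apply: le_trans le1 _.
by rewrite -leeBlDr// ltW.
Qed.

Variables (l : R) (s : 'I_J -> nat -> R) (P : 'M[R]_J.+1).
Hypotheses (l_ge0 : 0 <= l) (s_ge0 : forall k x, (0 < x)%N -> 0 <= s k x) (P_st : stochastic P).

(* Only external arrivals increase the total population, and their total rate
   is at most [l]. *)
Lemma level_flux (pi : state J -> R) N : (forall n, 0 <= pi n) ->
  (\esum_(n in [set n | total n <= N]%N)
     \esum_(m in ~` [set n | total n <= N]%N) (pi n * rate l s P n m)%:E
   <= l%:E * (\esum_(n in [set n | total n = N]) (pi n)%:E))%E.
Proof.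
move=> pi_ge0; rewrite -esumZl//.
rewrite [leLHS]esum_mkcond [leRHS]esum_mkcond; apply: le_esum => n _.
case: ifPn => [/set_mem /= nN|_]; last first.
  by case: ifP => _; rewrite ?mule_ge0 ?lee_fin.
(* A move adds at most one customer, and one leaving a node other than 0 also removes one; so
   crossing the level needs an arrival at population exactly [N]. *)
have up m j i : ~ (total m <= N)%N -> service l s n j != 0 ->
    m = addc (remc n j) i -> j = ord0 /\ total n = N.
  move=> mN /service_occupied/total_remc nE mE; move: mN nN nE; rewrite mE total_addc.
  by have [->|_] := eqVneq j ord0; case: (i != ord0) => /= *; first (split=> //); lia.
case: ifPn => [/set_mem /= nEN|nEN]; last first.
  rewrite esum1// => m /= mN; rewrite rateE big1 ?mulr0// => j _.
  rewrite big1// => i _; case: eqP => [mE|_]; last by rewrite mul0r.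
  have [->|sj] := eqVneq (service l s n j) 0; first by rewrite mul0r mulr0.
  by case/negP: nEN; apply: mem_set; have [] := up m j i mN sj mE.
rewrite (muleC l%:E).
(* The term [i = ord0], absent from the rate, is included so that row 0 of [P] sums to 1. *)
apply: (@le_trans _ _ (\esum_(m in [set: state J])
    ((pi n)%:E * (\sum_i (m == addc n i)%:R * (l * P ord0 i))%:E))%E).
  rewrite [leLHS]esum_mkcond le_esum// => m _; case: ifPn => [/set_mem /= mN|_].
    rewrite lee_fin ler_wpM2l// rateE big_ord_recl [X in _ + X]big1 ?addr0.
      rewrite service0 remc0 [leRHS](bigID (fun i => i != ord0))/= lerDl.
      by apply: sumr_ge0 => i _; rewrite !mulr_ge0// P_st.1.
    move=> k _; rewrite big1// => i _; case: eqP => [mE|_]; last by rewrite mul0r.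
    have [->|sj] := eqVneq (service l s n (lift ord0 k)) 0; first by rewrite mul0r mulr0.
    have [] := up m _ i mN sj mE.
    by move/eqP; rewrite -/(ext k) ext_eq0.
  by rewrite lee_fin mulr_ge0// sumr_ge0// => i _; rewrite !mulr_ge0// P_st.1.
have in_ge0 i m : 0 <= (m == addc n i)%:R * (l * P ord0 i).
  by rewrite !mulr_ge0// P_st.1.
rewrite esumZl//; last by move=> m; rewrite lee_fin sumr_ge0.
rewrite lee_wpmul2l ?lee_fin//; under eq_esum do rewrite -sumEFin.
rewrite esum_sum; last by move=> *; rewrite lee_fin.
under eq_bigr => i _.
  rewrite (esum_point (z := addc n i))//=; last 2 first.
  - by rewrite lee_fin.
  - by move=> m /negbTE ->; rewrite mul0r.
  rewrite eqxx mul1r.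
  over.
by rewrite sumEFin -mulr_sumr P_st.2 mulr1.
Qed.

Lemma rate_recurrent (pi : state J -> R) : stationary (rate l s P) pi ->
  (forall n, 0 < pi n) -> ctmc_irreducible (rate l s P) -> (0 < J)%N ->
  jump_recurrent (rate l s P).
Proof.
move=> pi_st pi_gt0 irr J_gt0.
have [pi_ge0 pi1 _] := pi_st.
apply: (jump_recurrent_of_flux (pi := pi)) => //.
- exact: rate_ge0.
- exact: stable_rate.
- move=> n; pose m := addc n (ext (Ordinal J_gt0)).
  have := irr n m; have nm : n <> m.
    by rewrite -{1}(addc0 n) => /addc_inj /esym/eqP; rewrite ext_eq0.
  move=> /clos_rt_rt1n_iff nm'; case: nm' nm => [//|y z ny _ _].
  by exists y.
move=> o e e_gt0.
(* Level mass [e / (l + 1)] keeps the divisor positive even if [l = 0], and [l / (l + 1) <= 1].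
   Starting at [total o] puts [o] into the set. *)
have l1_gt0 : 0 < l + 1 by rewrite ltr_wpDl.
have [N oN small] := esum_level_small (total o) pi_ge0 pi1 (divr_gt0 e_gt0 l1_gt0).
exists [set n | (total n <= N)%N]; first by split=> //; exact: finite_total_le.
apply: le_trans (level_flux N pi_ge0) _.
apply: (@le_trans _ _ (l%:E * (e / (l + 1))%:E)%E).
  by rewrite lee_wpmul2l// lee_fin.
rewrite -EFinM lee_fin mulrCA -[leRHS]mulr1 ler_wpM2l ?(ltW e_gt0)//.
by rewrite ler_pdivrMr// mul1r lerDl.
Qed.

End LevelFlux.

(** * Normalization and local balance of the product form *)

Section ProductForm.
Variables (R : realType) (J : nat).
Implicit Types (n : state J) (phi : state J -> R).

Definition clear (ks : seq 'I_J) n : state J :=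
  [ffun k => if k \in ks then 0%N else n k].

(** Adjoins one independent coordinate: a state is a pair of its [k]-th entry and its copy cleared
    at [k], and [phi] lives on the cleared states. *)
Lemma esum_product_step (f : nat -> R) (k : 'I_J) phi :
  (forall x, 0 <= f x) -> (\esum_(x in [set: nat]) (f x)%:E = 1)%E ->
  (forall n, 0 <= phi n) -> (forall n, phi n <> 0 -> n k = 0%N) ->
  (\esum_(n in [set: state J]) (f (n k) * phi (clear [:: k] n))%:E
   = \esum_(n in [set: state J]) (phi n)%:E)%E.
Proof.
move=> f_ge0 f1 phi_ge0 phi_supp.
pose Z := [set n : state J | n k = 0%N].
pose e (p : state J * nat) : state J := [ffun k' => if k' == k then p.2 else p.1 k'].
have clear_e n x : Z n -> clear [:: k] (e (n, x)) = n.
  move=> nk; apply/ffunP => k'; rewrite !ffunE inE.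
  by case: eqP => [->|//]; rewrite nk.
rewrite (reindex_esum (Z `*`` (fun=> setT)) _ e); last first.
  split=> //.
  - move=> [n x] [n' x'] /set_mem[/= nZ _] /set_mem[/= n'Z _] ee; congr (_, _).
      by rewrite -(clear_e n x nZ) ee clear_e.
    by have := congr1 (fun m : state J => m k) ee; rewrite !ffunE eqxx.
  - move=> n _; exists (clear [:: k] n, n k) => /=.
      by split=> //; rewrite /Z /= ffunE inE eqxx.
    by apply/ffunP => k'; rewrite !ffunE inE; case: eqP => [->|].
transitivity (\esum_(n in Z) \esum_(x in [set: nat])
    (f (e (n, x) k) * phi (clear [:: k] (e (n, x))))%:E)%E.
  rewrite esum_esum; last by move=> n x _ _; rewrite lee_fin mulr_ge0.
  by apply: eq_esum => -[].
rewrite [LHS]esum_mkcond; apply: eq_esum => n _; case: ifPn => [/set_mem nZ|nZ].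
  under eq_esum => x _ do rewrite clear_e// ffunE eqxx mulrC EFinM.
  by rewrite esumZl ?f1 ?mule1// => x; rewrite lee_fin.
congr (_%:E); apply/esym/eqP; apply: contraNT nZ => /eqP phin.
by apply: mem_set; exact: phi_supp.
Qed.

Lemma esum_product (f : 'I_J -> nat -> R) (ks : seq 'I_J) phi :
  (forall k x, 0 <= f k x) -> (forall k, \esum_(x in [set: nat]) (f k x)%:E = 1)%E ->
  uniq ks -> (forall n, 0 <= phi n) ->
  (forall n, phi n <> 0 -> forall k, k \in ks -> n k = 0%N) ->
  (\esum_(n in [set: state J]) (\prod_(k <- ks) f k (n k) * phi (clear ks n))%:E
   = \esum_(n in [set: state J]) (phi n)%:E)%E.
Proof.
move=> f_ge0 f1; elim: ks phi => [|k ks IH] phi /= uks phi_ge0 phi_supp.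
  apply: eq_esum => n _; rewrite big_nil mul1r; congr (phi _)%:E.
  by apply/ffunP => k; rewrite ffunE.
have /andP[kks {}uks] := uks.
rewrite -(@esum_product_step (f k) k phi)//; last first.
  by move=> n /phi_supp; apply; exact: mem_head.
(* The induction hypothesis is used for [phi] with coordinate [k] already adjoined; its support
   still vanishes on [ks] because [k] is not in [ks]. *)
rewrite -[RHS]IH//; last 2 first.
- by move=> n; rewrite mulr_ge0.
- move=> n phin k' k'ks; have kk' : k' == k = false.
    by apply/negbTE; apply: contraNneq kks => <-.
  have phin' : phi (clear [:: k] n) <> 0 by move=> p0; apply: phin; rewrite p0 mulr0.
  have := phi_supp _ phin' k'; rewrite !inE k'ks orbT => /(_ isT).
  by rewrite ffunE inE kk'.
apply: eq_esum => n _; rewrite big_cons ffunE (negbTE kks).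
rewrite (_ : clear [:: k] (clear ks n) = clear (k :: ks) n).
  by congr (_%:E); ring.
by apply/ffunP => k'; rewrite !ffunE !inE; case: eqP.
Qed.

Variables (eta : 'I_J.+1 -> R) (mu : 'I_J -> nat -> R).
Hypotheses (eta_gt0 : forall j, 0 < eta j)
  (mu_gt0 : forall k x, (0 < x)%N -> 0 < mu k x)
  (C_fin : forall k, (Cnorm eta mu k < +oo)%E).

Lemma cterm_gt0 k x : 0 < cterm eta mu k x.
Proof.
rewrite /cterm big_nat_cond; apply: prodr_gt0 => i.
by rewrite andbT => /andP[i1 _]; rewrite divr_gt0// mu_gt0.
Qed.

Lemma ctermS k x : cterm eta mu k x.+1 * mu k x.+1 = eta (ext k) * cterm eta mu k x.
Proof.
rewrite /cterm big_nat_recr//= -mulrA divfK 1?mulrC//.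
by rewrite gt_eqF// mu_gt0.
Qed.

Lemma CnormK k : (fine (Cnorm eta mu k))%:E = Cnorm eta mu k.
Proof.
by rewrite fineK// ge0_fin_numE// esum_ge0// => x _; rewrite lee_fin ltW// cterm_gt0.
Qed.

Lemma Cnorm_gt0 k : 0 < fine (Cnorm eta mu k).
Proof.
rewrite -lte_fin CnormK.
apply: lt_le_trans (esum_le_term (fun x => (cterm eta mu k x)%:E) (z := 0%N) _) => //.
by rewrite lte_fin cterm_gt0.
Qed.

Let marg k x := cterm eta mu k x / fine (Cnorm eta mu k).

Let marg_gt0 k x : 0 < marg k x.
Proof. by rewrite divr_gt0 ?cterm_gt0 ?Cnorm_gt0. Qed.

Let marg1 k : (\esum_(x in [set: nat]) (marg k x)%:E = 1)%E.
Proof.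
under eq_esum do rewrite /marg mulrC EFinM.
rewrite esumZl; [|by rewrite invr_ge0 ltW// Cnorm_gt0|]; last first.
  by move=> x; rewrite lee_fin ltW// cterm_gt0.
by rewrite -/(Cnorm eta mu k) -CnormK -EFinM mulVf// gt_eqF// Cnorm_gt0.
Qed.

Variables (B : 'I_J -> bool) (phi : state J -> R).
Hypotheses (phi_ge0 : forall n, 0 <= phi n)
  (phi_supp : forall n, phi n <> 0 -> restrictB B n = n)
  (phi1 : (\esum_(n in [set: state J]) (phi n)%:E = 1)%E).

Lemma xi_phi_ge0 n : 0 <= xi_phi eta mu B phi n.
Proof. by rewrite mulr_ge0// prodr_ge0// => k _; exact/ltW/marg_gt0. Qed.

(** A law on the coordinates in [B] is encoded as [phi] on states that vanish off [B]; the marginals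
    of the other nodes are adjoined to it. *)
Lemma xi_phi_mass : (\esum_(n in [set: state J]) (xi_phi eta mu B phi n)%:E = 1)%E.
Proof.
pose ks := [seq k <- index_enum (ordinal J) | ~~ B k].
have mem_ks k : (k \in ks) = ~~ B k by rewrite mem_filter mem_index_enum andbT.
have clearE n : clear ks n = restrictB B n.
  by apply/ffunP => k; rewrite !ffunE mem_ks; case: (B k).
rewrite -phi1 -(@esum_product marg ks phi)//.
- by apply: eq_esum => n _; rewrite clearE big_filter.
- by move=> k x; exact/ltW/marg_gt0.
- by rewrite filter_uniq// index_enum_uniq.
- by move=> n /phi_supp <- k; rewrite mem_ks ffunE => /negbTE ->.
Qed.

(** This is the hypothesis [pi_addc] of the balance argument. At a node in [B] both sides vanish;
    elsewhere [phi] does not see the added customer and consecutive [cterm] have ratio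
    [eta / mu]. *)
Lemma xi_phi_addc (gamma : 'I_J -> R) l n j : (forall k, B k -> gamma k = 0) ->
  let s k x := gamma k * mu k x in
  xi_phi eta mu B phi (addc n j) * service l s (addc n j) j
  = (if unlift ord0 j is Some k then gamma k * eta (ext k) else l)
    * xi_phi eta mu B phi n.
Proof.
move=> gB s; case: (unliftP ord0 j) => [k ->|->]; last first.
  by rewrite addc0 service0 mulrC.
rewrite -/(ext k) service_ext ffunE eqxx addn1 /s mul1r.
have [/gB ->|Bk] := boolP (B k); first by rewrite !mul0r mulr0.
rewrite /xi_phi.
have -> : restrictB B (addc n (ext k)) = restrictB B n.
  apply/ffunP => k'; rewrite !ffunE ext_eq; case: ifP => // Bk'.
  by case: eqP => [k'k|_]; rewrite ?addn0//; move: Bk; rewrite -k'k Bk'.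
rewrite (bigD1 k)//= [in RHS](bigD1 k)//= ffunE eqxx addn1.
under eq_bigr => k' /andP[_ k'k].
  rewrite ffunE ext_eq (negbTE k'k) addn0; over.
set p := \prod_(_ | _) _.
transitivity (gamma k * (cterm eta mu k (n k).+1 * mu k (n k).+1)
   / fine (Cnorm eta mu k) * p * phi (restrictB B n)); first by ring.
by rewrite ctermS; ring.
Qed.

End ProductForm.

(** * Splitting [gamma] into a time scale [beta] and acceptance probabilities *)

Section SkippingParameters.
Variables (R : realType) (J : nat) (gamma : 'I_J -> R).
Hypothesis gamma_ge0 : forall k, 0 <= gamma k.

Lemma supnorm_ge k : gamma k <= supnorm gamma.
Proof. exact: le_bigmax. Qed.

Lemma beta_gt0 : 0 < beta_of gamma.
Proof.
by rewrite /beta_of; case: (leP (supnorm gamma)) => // g1; exact: lt_trans ltr01 g1.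
Qed.

Lemma alpha0 : alpha_of gamma ord0 = 1.
Proof. by rewrite /alpha_of unlift_none. Qed.

Lemma beta_alpha k : beta_of gamma * alpha_of gamma (ext k) = gamma k.
Proof.
rewrite /beta_of /alpha_of liftK; case: (leP (supnorm gamma)) => [_|g1]; first by rewrite mul1r.
by rewrite mulrC divfK// gt_eqF// (lt_trans _ g1).
Qed.

Lemma alpha01 j : 0 <= alpha_of gamma j <= 1.
Proof.
rewrite /alpha_of; case: unlift => [k|]; last by rewrite ler01 lexx.
case: (leP (supnorm gamma)) => [g1|g1]; first by rewrite gamma_ge0 (le_trans (supnorm_ge k)).
have g0 : 0 < supnorm gamma by rewrite (lt_trans _ g1).
by rewrite divr_ge0 ?(ltW g0)//= ler_pdivrMr// mul1r supnorm_ge.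
Qed.

End SkippingParameters.

(** * Stationarity, ergodicity and splitting of the modified network *)

Theorem theorem3p5 (R : realType) (J : nat)
  (lambda : R) (r : 'M[R]_J.+1) (mu : 'I_J -> nat -> R)
  (eta : 'I_J.+1 -> R) (gamma : 'I_J -> R) :
  (* extended routing matrix: stochastic, irreducible, r(0,0) = 0 *)
  0 < lambda ->
  stochastic r -> mx_irreducible r -> r ord0 ord0 = 0 ->
  (* service intensities *)
  (forall j k, (0 < k)%N -> 0 < mu j k) ->
  (* extended traffic equations *)
  eta ord0 = lambda ->
  (forall j, eta j = \sum_i eta i * r i j) ->
  (* C(j) < oo *)
  (forall j, (Cnorm eta mu j < +oo)%E) ->
  (* the Jackson network process X is ergodic *)
  ergodic (jackson_rate (fun i => lambda * r ord0 (ext i)) mu r) ->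
  (* gamma in [0,oo)^J *)
  (forall j, 0 <= gamma j) ->
  let alpha := alpha_of gamma in
  let beta := beta_of gamma in
  let ralpha := skip r alpha in
  let qg := jackson_rate (fun i => beta * lambda * ralpha ord0 (ext i))
                         (fun j k => gamma j * mu j k) ralpha in
  let B := fun j => gamma j == 0 in
  stationary qg (xi eta mu)
  /\ ((forall j, ~~ B j) -> ergodic qg)
  /\ ((exists j, B j) ->
      [/\ ~ ctmc_irreducible qg,
          (forall b : state J,
             ctmc_closed qg [set n | forall j, B j -> n j = b j]) &
          (forall phi : state J -> R,
             (forall n, 0 <= phi n) ->
             (forall n, phi n <> 0 -> restrictB B n = n) ->
             \esum_(n in [set: state J]) (phi n)%:E = 1%E ->
             stationary qg (xi_phi eta mu B phi))]).
Proof.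
move=> lambda_gt0 r_st r_irr r00 mu_gt0 eta0 etaE C_fin _ gamma_ge0 alpha beta P qg B.
have eta_gt0 : forall j, 0 < eta j.
  by apply: (invariant_gt0 r_st r_irr etaE (i0 := ord0)); rewrite eta0.
have a01 := alpha01 gamma_ge0; have a0 := alpha0 gamma.
have beta_pos : 0 < beta := beta_gt0 gamma.
have P_st : stochastic P := skip_stochastic r_st r_irr a01 a0.
have l_gt0 : 0 < beta * lambda by rewrite mulr_gt0.
have s_ge0 k x : (0 < x)%N -> 0 <= gamma k * mu k x.
  by move=> x_gt0; rewrite mulr_ge0// ltW// mu_gt0.
pose theta j := if unlift ord0 j is Some k then gamma k * eta (ext k)
                else beta * lambda.
have thetaE j : theta j = beta * (alpha j * eta j).
  rewrite /theta; case: (unliftP ord0 j) => [k ->|->].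
    by rewrite -/(ext k) mulrA beta_alpha.
  by rewrite eta0 [alpha _]a0 mul1r.
have theta_inv j : theta j = \sum_i theta i * P i j.
  rewrite thetaE (skip_invariant r_st r_irr a01 a0 etaE) mulr_sumr.
  by apply: eq_bigr => i _; rewrite thetaE !mulrA.
(* [B'] may be any set of nodes with [gamma = 0]: the empty set yields [xi], and [B] yields
   [xi_phi]. *)
have stat (B' : 'I_J -> bool) phi : (forall k, B' k -> gamma k = 0) ->
    (forall n, 0 <= phi n) -> (forall n, phi n <> 0 -> restrictB B' n = n) ->
    \esum_(n in [set: state J]) (phi n)%:E = 1%E ->
    stationary qg (xi_phi eta mu B' phi).
  move=> B'gamma phi_ge0 phi_supp phi1.
  apply: (stationary_rate (ltW l_gt0) s_ge0 P_st (theta := theta)) => //.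
  - exact: xi_phi_ge0.
  - by move=> n j; exact: xi_phi_addc.
  - exact: xi_phi_mass.
pose z : state J := [ffun=> 0%N].
have xi_st : stationary qg (xi eta mu).
  (* With no frozen coordinate, the law [phi] is the point mass at the empty state. *)
  have -> : xi eta mu = xi_phi eta mu (fun=> false) (fun n => (n == z)%:R).
    apply/funext => n; rewrite /xi_phi (_ : restrictB _ n = z) ?eqxx ?mulr1//.
  apply: stat => //.
  - move=> n nz; apply/ffunP => k; rewrite ffunE.
    by have [->|/negbTE nz'] := eqVneq n z; [rewrite ffunE|rewrite nz' in nz].
  - rewrite (esum_point (z := z)) ?eqxx//.
    by move=> n /negbTE ->.
split=> //; split=> [B0|[k0 Bk0]].
  have gamma_gt0 k : 0 < gamma k by rewrite lt_neqAle eq_sym B0 gamma_ge0.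
  (* For [J = 0] row 0 of [r] would consist of [r ord0 ord0 = 0] only, against row sum 1. *)
  have J_gt0 : (0 < J)%N.
    have := r_st.2 ord0; rewrite big_ord_recl r00 add0r.
    case: posnP => // J0; rewrite big1 => [/eqP|k _]; first by rewrite eq_sym oner_eq0.
    by have : (k < 0)%N by rewrite -[X in (_ < X)%N]J0.
  have irr : ctmc_irreducible qg.
    apply: (rate_irreducible l_gt0 _ P_st r_st r_irr) => [k x x_gt0|i j rij].
      by rewrite mulr_gt0// mu_gt0.
    apply: lt_le_trans (skip_ge r_st r_irr a01 a0 i j).
    rewrite mulr_gt0//; case: (unliftP ord0 j) => [k ->|->]; last by rewrite a0.
    by rewrite -(pmulr_rgt0 _ beta_pos) -/(ext k) beta_alpha.
  split=> //; first exact: (stable_rate (ltW l_gt0) s_ge0 P_st).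
    apply: (rate_recurrent (ltW l_gt0) s_ge0 P_st xi_st) => // n.
    by apply: prodr_gt0 => k _; rewrite divr_gt0 ?cterm_gt0 ?Cnorm_gt0.
  by exists (xi eta mu).
(* A node with [gamma = 0] has no departures because its service rate is 0, and no arrivals because
   its column of the skipping matrix is 0. *)
have closedB (b : state J) : ctmc_closed qg [set n | forall k, B k -> n k = b k].
  move=> n m /= nb /(qstep_moveP (ltW l_gt0) s_ge0 P_st)[j [i [-> sj Pji]]] k Bk.
  have kj : ext k == j = false.
    apply/negbTE; apply: contraNneq sj => <-.
    by rewrite service_ext (eqP Bk) mul0r mulr0.
  have ki : ext k == i = false.
    apply/negbTE; apply: contraNneq Pji => <-; rewrite skip_col0//.
    apply/eqP; have := Bk; rewrite /B -beta_alpha mulf_eq0 gt_eqF//.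
  by rewrite !ffunE kj ki subn0 addn0 nb.
split=> //; last by move=> phi; apply: stat => k /eqP.
(* The empty state cannot reach the state with one customer at [k0], which lies outside its closed
   class. *)
move=> /(_ z (addc z (ext k0)))/(closed_reach (closedB z) (fun _ _ => erefl)).
by move=> /(_ k0 Bk0); rewrite !ffunE eqxx.
Qed.
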